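(* For every $\alpha>0$ there exists a constant $C>0$ depending only on $\alpha$ such that the following holds. If $(G_n)$ is a $(d,\alpha)$ directed expander family with $|V(G_n)|=n$ for every index $n$ of the family, then for all $n$ and all $x,y\in V(G_n)$, $$\mathbb{E}_x(\tau_y)<Cn,$$ where $\mathbb{E}_x(\tau_y)$ is the expected hitting time of $y$ for the simple random walk on $G_n$ started from $x$.
   Context: All graphs are finite directed graphs (self-loops are allowed). The simple random walk on a digraph in which every vertex has outdegree $d$ moves at each step from its current vertex along one of the $d$ outgoing edges chosen uniformly at random. If every vertex of $G=(V,E)$ has both indegree and outdegree $d$, the uniform distribution on $V$ is stationary, and the bottleneck ratio of a nonempty set $S\subset V$ for this walk is $\Phi(S)=\frac{E(S,S^c)}{d|S|}$, where $E(S,S^c)$ is the number of edges going from $S$ to $S^c=V\setminus S$. The bottleneck ratio of the walk is $\Phi_*(G)=\min\{\Phi(S): S\subset V,\ 1\le |S|\le |V|/2\}$. A family $(G_n)$ of digraphs is a $(d,\alpha)$ directed expander family if: (i) $\lim_{n\to\infty}|V(G_n)|=\infty$; (ii) for all $n$, every vertex of $G_n$ has both indegree and outdegree equal to $d$; (iii) $\Phi_*(G_n)\ge\alpha$ for all $n$ (this condition being vacuous when $|V(G_n)|=1$). The hitting time is $\tau_y=\min\{t\ge0: X_t=y\}$, where $X_t$ is the walk. *)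

(* Defs.v *)
From HB Require Import structures.
From mathcomp Require Import all_boot all_order all_algebra.
From mathcomp Require Import all_classical all_reals all_analysis.

Set Implicit Arguments.
Unset Strict Implicit.
Unset Printing Implicit Defensive.

Import Order.TTheory GRing.Theory Num.Theory.
Import numFieldNormedType.Exports.

Local Open Scope classical_set_scope.
Local Open Scope ring_scope.

(* Self-loops and parallel edges are allowed; a digraph without parallel edges
   is one in which [fun e => (src e, tgt e)] is injective. *)
Record digraph := Digraph {
  vertex : finType;
  edge : finType;
  src : edge -> vertex;
  tgt : edge -> vertex
}.

Definition outdeg (G : digraph) (v : vertex G) : nat :=
  #|[pred e : edge G | src e == v]|.

Definition indeg (G : digraph) (v : vertex G) : nat :=
  #|[pred e : edge G | tgt e == v]|.

Definition edges_out (G : digraph) (S : {set vertex G}) : nat :=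
  #|[pred e : edge G | (src e \in S) && (tgt e \notin S)]|.

Section Bottleneck.
Variables (R : realType) (d : nat) (G : digraph).

Definition bottleneck_ratio_of (S : {set vertex G}) : R :=
  (edges_out S)%:R / (d%:R * #|S|%:R).

(* Extended-real valued, so that the minimum over no set at all
   (at most one vertex) is +oo. *)
Definition bottleneck_ratio : \bar R :=
  \big[Order.min/+oo%E]_(S : {set vertex G} |
      (1 <= #|S|)%N && (2 * #|S| <= #|vertex G|)%N)
    (bottleneck_ratio_of S)%:E.

End Bottleneck.

(* The family is [(G n)_(n in I)] for an infinite set [I] of indices; the values
   of [G] outside [I] are irrelevant. *)
Definition directed_expander_family (R : realType) (d : nat) (alpha : R)
    (I : set nat) (G : nat -> digraph) : Prop :=
  [/\ infinite_set I,
      #|vertex (G n)| @[n --> within I \oo] --> \oo,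
      forall n, I n -> forall v : vertex (G n), indeg v = d /\ outdeg v = d &
      forall n, I n -> (alpha%:E <= bottleneck_ratio R d (G n))%E].

Section Walk.
Variables (R : realType) (d : nat) (G : digraph).

Definition walk_step (u v : vertex G) : R :=
  #|[pred e : edge G | (src e == u) && (tgt e == v)]|%:R / d%:R.

(* The Markov property is stated multiplicatively, which avoids conditioning on
   trajectories of probability zero. *)
Definition simple_random_walk (disp : measure_display)
    (Omega : measurableType disp) (P : probability Omega R)
    (X : nat -> Omega -> vertex G) (x : vertex G) : Prop :=
  [/\ forall t v, measurable [set o | X t o = v],
      P [set o | X 0%N o = x] = 1%E &
      forall (t : nat) (w : nat -> vertex G),
        P [set o | forall i, (i <= t.+1)%N -> X i o = w i] =
        (P [set o | forall i, (i <= t)%N -> X i o = w i] *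
         (walk_step (w t) (w t.+1))%:E)%E].

(* +oo on the trajectories that never visit [y]. *)
Definition hitting_time (Omega : Type) (X : nat -> Omega -> vertex G)
    (y : vertex G) (o : Omega) : \bar R :=
  ereal_inf [set (t%:R)%:E | t in [set t : nat | X t o = y]].

End Walk.

(* Main.v *)
Require Import Defs.
From mathcomp Require Import all_boot all_order all_algebra.
From mathcomp Require Import all_classical all_reals all_analysis.
From mathcomp Require Import measurable_realfun ring lra.

Import Order.TTheory GRing.Theory Num.Theory.
Import numFieldNormedType.Exports.

Local Open Scope classical_set_scope.
Local Open Scope ring_scope.

(** The walk has a doubly stochastic transition matrix [p]: rows sum to 1
    because every outdegree is [d], columns because every indegree is [d].  Fix
    the target [y] and let [h x] be the expectation of [min tau_y k] from [x].
    First-step analysis gives [h y = 0] and [h x <= 1 + (p h) x] for [x <> y];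
    truncating at [k] keeps [h] finite.  The bounds below hold for every [h]
    subject to these conditions, hence uniformly in [k], and pass to the limit.

    Cut the graph at a level [t > 0], with [S = {h >= t}] and complement [T],
    which contains [y].  Summing [h - p h <= 1] over [S] and using that [p] is
    doubly stochastic (so that [h] may be replaced by [h - t]) leaves
    [sum_(v in T) (t - h v) p(S, v) <= |S|]: the flow out of [S] cannot land
    far below [t] on average ([flow_drop_le]).  Expansion makes this flow at
    least [a min(|S|, |T|)], while a single vertex receives at most 1, so by
    Markov's inequality many vertices of [T] lie just below the level [t]
    ([flow_levels_le]).

    If [S] is the small side, lowering [t] by [2 / a] multiplies [|S|] by at
    least [1 + a / 2] ([above_growth]), so [h] exceeds its median by [O(n)],
    in fact by [O(log n)] ([above_height]).  If [T] is the small side, lowering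
    [t] by [2 n / (a |T|)] multiplies [|T|] by at most [1 - a / 2]
    ([below_decay]); these drops form a geometric series dominated by its last
    term, where [|T|] is of order 1, so the median of [h] is [O(n)]
    ([below_height]).  Together, [h < C n] with [C] depending only on [a]
    ([subsolution_lt]).

    On the probability space, [tau_y] is the sum over [k] of the indicators of
    the events that [y] is not hit up to time [k], and the probabilities of
    these events are computed from those of the paths ([prob_path_then_avoid]);
    the partial sums of the series for the expectation of [tau_y] are then at
    most the values [h x] above. *)

(** * Level sets of subsolutions of a doubly stochastic matrix *)

Definition flow {R : realType} {V : finType} (p : V -> V -> R)
    (A B : {set V}) : R :=
  \sum_(u in A) \sum_(v in B) p u v.

Definition above {R : realType} {V : finType} (h : V -> R) (t : R) : {set V} :=
  [set v | t <= h v]%SET.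

Section LevelSets.
Variables (R : realType) (V : finType) (p : V -> V -> R) (a : R).
Hypothesis p_ge0 : forall u v, 0 <= p u v.
Hypothesis p_row : forall u, \sum_v p u v = 1.
Hypothesis p_col : forall v, \sum_u p u v = 1.

(** With unit row and column sums, both flows are [#|A|] minus the flow from [A]
    to itself. *)
Lemma flow_setC (A : {set V}) : flow p A (~: A)%SET = flow p (~: A)%SET A.
Proof.
have row : flow p A A + flow p A (~: A)%SET = #|A|%:R.
  rewrite /flow -big_split /= -sumr_const; apply: eq_bigr => u _.
  rewrite -[RHS](p_row u) [RHS](bigID (mem A)) /=; congr (_ + _).
  by apply: eq_bigl => v; rewrite finset.in_setC.
have col : flow p A A + flow p (~: A)%SET A = #|A|%:R.
  rewrite /flow [X in X + _]exchange_big [X in _ + X]exchange_big -big_split /=.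
  rewrite -sumr_const; apply: eq_bigr => v _.
  rewrite -[RHS](p_col v) [RHS](bigID (mem A)) /=; congr (_ + _).
  by apply: eq_bigl => u; rewrite finset.in_setC.
by apply: (addrI (flow p A A)); rewrite row col.
Qed.

Hypothesis a_gt0 : 0 < a.
Hypothesis a_le1 : a <= 1.
Hypothesis expansion : forall A : {set V},
  (0 < #|A|)%N -> (2 * #|A| <= #|V|)%N ->
  a * #|A|%:R <= flow p A (~: A)%SET.

Fact two_le_2div : 2 <= 2 / a.
Proof. by rewrite ler_pdivlMr //; have := a_le1; lra. Qed.

Variables (h : V -> R) (y : V).
Hypothesis h_y : h y = 0.
Hypothesis h_sub : forall x, x != y -> h x <= 1 + \sum_v p x v * h v.

(** This is [h - p h <= 1] summed over [above h t]: as [p] has unit row sums,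
    [h] may be replaced by [h - t] there, and after exchanging the sums the
    terms [(h v - t) (1 - p(above h t, v))] of the vertices [v] above [t] are
    nonnegative, because the column of [v] sums to 1. *)
Lemma flow_drop_le (t : R) : 0 < t ->
  \sum_(v in ~: above h t) (t - h v) * (\sum_(u in above h t) p u v) <=
  #|above h t|%:R.
Proof.
move=> t_gt0; set A := above h t.
have yA : y \notin A by rewrite inE h_y -ltNge.
have sub : \sum_(u in A) (h u - t) - \sum_(u in A) \sum_v p u v * (h v - t)
           <= #|A|%:R.
  rewrite -sumrB -sumr_const; apply: ler_sum => u uA.
  have uy : u != y by apply: contraNneq yA => <-.
  under eq_bigr do rewrite mulrBr.
  rewrite sumrB -mulr_suml p_row mul1r.
  by have := h_sub u uy; lra.
apply: le_trans sub.
rewrite exchange_big [X in _ - X](bigID (mem A)) /=.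
have -> : \sum_(v in ~: A) (t - h v) * (\sum_(u in A) p u v) =
   - \sum_(v | v \notin A) \sum_(u in A) p u v * (h v - t).
  rewrite -sumrN; apply: eq_big => [v|v _]; first by rewrite finset.in_setC.
  by rewrite -mulr_suml -mulrN opprB mulrC.
rewrite opprD addrA lerDr subr_ge0; apply: ler_sum => v.
rewrite inE => tv; rewrite -mulr_suml ler_piMl ?subr_ge0 // -(p_col v).
by rewrite [leRHS](bigID (mem A)) /= lerDl sumr_ge0.
Qed.

(** Markov's inequality for [flow_drop_le]: the part of the flow landing more
    than [delta] below [t] is at most [#|above h t| / delta], and the rest is at
    most the number of vertices on which it lands, each column sum being 1. *)
Lemma flow_levels_le (t delta : R) : 0 < t -> 0 < delta ->
  flow p (above h t) (~: above h t)%SET <=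
  #|above h t|%:R / delta + (#|above h (t - delta)|%:R - #|above h t|%:R).
Proof.
move=> t_gt0 delta_gt0; set A := above h t; set B := above h (t - delta).
have sAB : A \subset B.
  by apply/fintype.subsetP => v; rewrite !inE; lra.
have -> : #|B|%:R - #|A|%:R = \sum_(v in ~: A) (v \in B)%:R :> R.
  rewrite -(cardsID A B) (finset.setIidPr sAB) natrD addrAC subrr add0r.
  rewrite -sumr_const [RHS]big_mkcond [LHS]big_mkcond; apply: eq_bigr => v _.
  by rewrite !inE; case: (t <= h v); case: (_ <= h v).
have cut :
  \sum_(v in ~: A) (t - h v) / delta * (\sum_(u in A) p u v)
    <= #|A|%:R / delta.
  rewrite ler_pdivlMr // mulr_suml; apply: le_trans (flow_drop_le _ t_gt0).
  apply: ler_sum => v _; rewrite -/A.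
  by rewrite mulrAC divfK // gt_eqF.
apply: le_trans (lerD cut (lexx _)).
rewrite /flow exchange_big -big_split /=; apply: ler_sum => v.
rewrite !inE -ltNge => vt.
have q_ge0 : 0 <= \sum_(u in A) p u v by apply: sumr_ge0.
have q_le1 : \sum_(u in A) p u v <= 1.
  by rewrite -(p_col v) [leRHS](bigID (mem A)) /= lerDl sumr_ge0.
have [vB|vB] := leP (t - delta) (h v) => /=.
  apply: (le_trans q_le1); rewrite lerDr mulr_ge0 // divr_ge0 ?subr_ge0 //;
    exact: ltW.
rewrite addr0 ler_peMl // ler_pdivlMr // mul1r; lra.
Qed.

(** The drop [2 / a] is such that at most half of the guaranteed flow
    [a * #|above h t|] lands lower than that. *)
Lemma above_growth (t : R) : 0 < t -> (0 < #|above h t|)%N ->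
  (2 * #|above h t| <= #|V|)%N ->
  (1 + a / 2) * #|above h t|%:R <= #|above h (t - 2 / a)|%:R.
Proof.
have a0 := a_gt0; have a1 := a_le1.
move=> t_gt0 A_gt0 A_small.
have d_gt0 : 0 < 2 / a by rewrite divr_gt0.
have := le_trans (expansion _ A_gt0 A_small) (flow_levels_le _ _ t_gt0 d_gt0).
by rewrite invf_div mulrDl mul1r; lra.
Qed.

(** Expansion is applied to the lower side, now the small one, and the drop is
    such that at most half of the guaranteed flow [a * #|~: above h t|] lands
    lower than that, [#|above h t|] being at most [#|V|]. *)
Lemma below_decay (t : R) : 0 < t -> (2 * #|~: above h t| <= #|V|)%N ->
  #|~: above h (t - 2 * #|V|%:R / (a * #|~: above h t|%:R))|%:R <=
  (1 - a / 2) * #|~: above h t|%:R.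
Proof.
have a0 := a_gt0; have a1 := a_le1.
move=> t_gt0 B_small; set B := (~: above h t)%SET.
have yB : y \in B by rewrite !inE h_y -ltNge.
have B_gt0 : (0 < #|B|)%N by apply/card_gt0P; exists y.
have B_gt0' : 0 < #|B|%:R :> R by rewrite ltr0n.
have V_gt0 : 0 < #|V|%:R :> R by rewrite ltr0n; apply/card_gt0P; exists y.
set delta := _ / _.
have d_gt0 : 0 < delta by rewrite divr_gt0 ?mulr_gt0.
have : a * #|B|%:R <= flow p (above h t) (~: above h t)%SET.
  by rewrite flow_setC -[X in flow p _ X]finset.setCK expansion.
move=> /le_trans /(_ (flow_levels_le _ _ t_gt0 d_gt0)).
have cardE s : #|above h s|%:R = #|V|%:R - #|~: above h s|%:R :> R.
  by rewrite -(cardsC (above h s)) natrD addrK.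
rewrite (cardE (t - delta)) (cardE t) -/B.
suff : (#|V|%:R - #|B|%:R) / delta <= a / 2 * #|B|%:R by lra.
rewrite ler_pdivrMr // /delta.
have -> : a / 2 * #|B|%:R * (2 * #|V|%:R / (a * #|B|%:R)) = #|V|%:R.
  by field; rewrite !gt_eqF.
lra.
Qed.

(** Iterating [above_growth] would bound the left-hand side logarithmically; a
    bound linear in the cardinal suffices and follows by induction, since each
    drop [2 / a] adds at least [a / 2] vertices. *)
Lemma above_height (k : nat) (x : V) (t : R) : (#|above h t| <= k)%N ->
  0 < t -> t <= h x -> (2 * #|above h t| <= #|V|)%N ->
  h x - t <= 4 / a ^+ 2 * #|above h t|%:R.
Proof.
have a0 := a_gt0; have a1 := a_le1.
elim: k t => [|k IHk] t Ak t_gt0 tx A_small.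
  by move: Ak; rewrite leqn0 cards_eq0 => /eqP/setP/(_ x); rewrite !inE tx.
have A_ge1 : 1 <= #|above h t|%:R :> R.
  by rewrite ler1n; apply/card_gt0P; exists x; rewrite inE.
have a2 : 4 / a ^+ 2 = 2 / a * (2 / a) by field; rewrite gt_eqF.
have da := two_le_2div.
have d_gt0 : 0 < 2 / a by lra.
have [xt|tx'] := ltP (h x) (t + 2 / a).
  rewrite a2 -mulrA.
  have : 2 / a * 1 <= 2 / a * (2 / a * #|above h t|%:R).
    by rewrite ler_pM2l //; nra.
  lra.
set A' := above h (t + 2 / a).
have A'_gt0 : (0 < #|A'|)%N by apply/card_gt0P; exists x; rewrite inE.
have sA : A' \subset above h t by apply/fintype.subsetP => v; rewrite !inE; lra.
have A'_small : (2 * #|A'| <= #|V|)%N.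
  by apply: leq_trans A_small; rewrite leq_mul2l subset_leq_card.
have t'_gt0 : 0 < t + 2 / a by lra.
have := above_growth _ t'_gt0 A'_gt0 A'_small; rewrite addrK -/A' => grow.
have A'1 : 1 <= #|A'|%:R :> R by rewrite ler1n.
have A'k : (#|A'| <= k)%N.
  rewrite -ltnS; apply: leq_trans Ak; rewrite -(ltr_nat R).
  by apply: lt_le_trans grow; nra.
have := IHk _ A'k t'_gt0 tx' A'_small; rewrite -/A' => IH.
suff : 4 / a ^+ 2 * #|A'|%:R + 2 / a <= 4 / a ^+ 2 * #|above h t|%:R by lra.
have c_gt0 : 0 < 4 / a ^+ 2 by rewrite a2 mulr_gt0.
apply: le_trans (_ : 4 / a ^+ 2 * ((1 + a / 2) * #|A'|%:R) <= _); last first.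
  by rewrite ler_pM2l.
have -> : 4 / a ^+ 2 * ((1 + a / 2) * #|A'|%:R) =
    4 / a ^+ 2 * #|A'|%:R + 2 / a * #|A'|%:R.
  by field; rewrite gt_eqF.
by rewrite lerD2l ler_peMr // ltW.
Qed.

(** With [q = 1 / (1 + a / 2)], the inverse cardinals of the successive lower
    sides are at most [1], [q], [q ^+ 2], and so on, from the lowest level
    upwards.  The sum of this series is [1 + 2 / a], and
    [2 / a / #|~: above h t|] is the sum of the terms beyond
    [1 / #|~: above h t|], which belong to levels above [t]. *)
Lemma below_height (k : nat) (t : R) : (#|~: above h t| <= k)%N ->
  0 < t -> (2 * #|~: above h t| <= #|V|)%N ->
  t <= 2 / a * #|V|%:R * (1 + 2 / a - 2 / a / #|~: above h t|%:R).
Proof.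
have a0 := a_gt0; have a1 := a_le1.
have yB s : 0 < s -> y \in ~: above h s by move=> s0; rewrite !inE h_y -ltNge.
elim: k t => [|k IHk] t Bk t_gt0 B_small.
  by move: Bk; rewrite leqn0 cards_eq0 => /eqP/setP/(_ y); rewrite yB // inE.
set B := (~: above h t)%SET in Bk B_small *.
have B_ge1 : 1 <= #|B|%:R :> R.
  by rewrite ler1n; apply/card_gt0P; exists y; exact: yB.
have B_gt0 : 0 < #|B|%:R :> R by lra.
have V_gt0 : 0 < #|V|%:R :> R by rewrite ltr0n; apply/card_gt0P; exists y.
set delta := 2 * #|V|%:R / (a * #|B|%:R).
have deltaE : delta = 2 / a * #|V|%:R / #|B|%:R.
  by rewrite /delta; field; rewrite !gt_eqF.
have c_gt0 : 0 < 2 / a * #|V|%:R by rewrite mulr_gt0 ?divr_gt0.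
have d_gt0 : 0 < delta by rewrite deltaE divr_gt0.
have b_gt0 : 0 < (#|B|%:R)^-1 :> R by rewrite invr_gt0.
have b_le1 : (#|B|%:R)^-1 <= 1 :> R by rewrite invf_le1.
have da := two_le_2div.
have [t_small|t_big] := leP t delta.
  apply: (le_trans t_small); rewrite deltaE ler_pM2l //.
  by nra.
have t'_gt0 : 0 < t - delta by lra.
have := below_decay _ t_gt0 B_small; rewrite -/B -/delta.
set B' := (~: above h (t - delta))%SET => decay.
have B'_ge1 : 1 <= #|B'|%:R :> R.
  by rewrite ler1n; apply/card_gt0P; exists y; exact: yB.
have B'_gt0 : 0 < #|B'|%:R :> R by lra.
have B'B : (#|B'| < #|B|)%N.
  by rewrite -(ltr_nat R); apply: le_lt_trans decay _; nra.
have B'k : (#|B'| <= k)%N by rewrite -ltnS; apply: leq_trans Bk.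
have B'_small : (2 * #|B'| <= #|V|)%N.
  by apply: leq_trans B_small; rewrite leq_mul2l ltnW.
have := IHk _ B'k t'_gt0 B'_small; rewrite -/B' => IH.
(* The decay [1 - a / 2] is at most [1 / (1 + a / 2)]. *)
have inv : (1 + a / 2) / #|B|%:R <= (#|B'|%:R)^-1.
  rewrite ler_pdivrMr // [leRHS]mulrC ler_pdivlMr //.
  apply: le_trans (_ : (1 + a / 2) * ((1 - a / 2) * #|B|%:R) <= _).
    by rewrite ler_pM2l //; lra.
  by nra.
have : t <= 2 / a * #|V|%:R * (1 + 2 / a - 2 / a / #|B'|%:R) + delta by lra.
move=> /le_trans; apply; rewrite deltaE -mulrDr ler_pM2l //.
have : 2 / a * ((1 + a / 2) / #|B|%:R) <= 2 / a / #|B'|%:R.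
  by rewrite ler_pM2l //; lra.
have -> : 2 / a * ((1 + a / 2) / #|B|%:R) = 2 / a / #|B|%:R + (#|B|%:R)^-1.
  by field; rewrite !gt_eqF.
lra.
Qed.

(** The level [t] of the proof is above the bound that [below_height] would give
    if the lower side were small, and too far below [h x] for [above_height] if
    the upper side were small; but one of the two sides is small. *)
Lemma subsolution_lt (x : V) : h x < (8 / a ^+ 2 + 2 / a + 1) * #|V|%:R.
Proof.
have a0 := a_gt0; have a1 := a_le1.
have V_gt0 : 0 < #|V|%:R :> R by rewrite ltr0n; apply/card_gt0P; exists y.
have da := two_le_2div.
have a2 : 4 / a ^+ 2 = 2 / a * (2 / a) by field; rewrite gt_eqF.
have a2' : 8 / a ^+ 2 = 2 * (2 / a * (2 / a)) by field; rewrite gt_eqF.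
rewrite ltNge; apply/negP => xbig.
pose t : R := (2 / a * (1 + 2 / a) + 1 / 2) * #|V|%:R.
have t_gt0 : 0 < t by rewrite mulr_gt0 //; nra.
have tx : t <= h x by apply: le_trans xbig; rewrite ler_pM2r // a2'; nra.
have [A_small|A_big] := leqP (2 * #|above h t|) #|V|.
  have := above_height _ x _ (leqnn _) t_gt0 tx A_small.
  have : #|above h t|%:R <= #|V|%:R :> R by rewrite ler_nat max_card.
  rewrite a2.
  have : 0 < 2 / a * (2 / a) by nra.
  move: xbig; rewrite /t a2'; nra.
have B_small : (2 * #|~: above h t| <= #|V|)%N.
  rewrite -(leq_add2l (2 * #|above h t|)) -mulnDr cardsC mul2n -addnn leq_add2r.
  exact: ltnW.
have := below_height _ _ (leqnn _) t_gt0 B_small.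
have : 0 <= 2 / a / #|~: above h t|%:R by rewrite divr_ge0 //; lra.
have : 0 < 2 / a * #|V|%:R by rewrite mulr_gt0 //; lra.
rewrite /t; nra.
Qed.

End LevelSets.

(** * The transition matrix of an expander *)

Lemma sum_walk_step_tgt (R : realType) (d : nat) (G : digraph) (u : vertex G) :
  \sum_v walk_step R d u v = (outdeg u)%:R / d%:R.
Proof.
rewrite -mulr_suml -natr_sum; congr (_%:R / _).
rewrite /outdeg -sum1_card (partition_big (@tgt G) predT) //=.
by apply: eq_bigr => v _; rewrite sum1_card.
Qed.

Lemma sum_walk_step_src (R : realType) (d : nat) (G : digraph) (v : vertex G) :
  \sum_u walk_step R d u v = (indeg v)%:R / d%:R.
Proof.
rewrite -mulr_suml -natr_sum; congr (_%:R / _).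
rewrite /indeg -sum1_card (partition_big (@src G) predT) //=.
apply: eq_bigr => u _; rewrite sum1_card.
by apply: eq_card => e; rewrite !inE andbC.
Qed.

Lemma flow_walk_step (R : realType) (d : nat) (G : digraph)
    (S : {set vertex G}) :
  flow (@walk_step R d G) S (~: S)%SET = (edges_out S)%:R / d%:R.
Proof.
rewrite /flow; under eq_bigr do rewrite -mulr_suml -natr_sum.
rewrite -mulr_suml -natr_sum; congr (_%:R / _).
rewrite /edges_out -sum1_card (partition_big (@src G) (mem S)) /=; last first.
  by move=> e /andP[].
apply: eq_bigr => u uS.
rewrite (partition_big (@tgt G) (mem (~: S)%SET)) /=; last first.
  by move=> e /andP[/andP[_]]; rewrite inE.
apply: eq_bigr => v; rewrite inE => vS; rewrite sum1_card.
apply: eq_card => e; rewrite [in RHS]unfold_in /= !inE.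
by have [->|_] := eqVneq (src e) u; have [->|_] := eqVneq (tgt e) v;
  rewrite ?andbF ?uS ?vS.
Qed.

Lemma bottleneck_ratio_le (R : realType) (d : nat) (alpha : R) (G : digraph)
    (S : {set vertex G}) :
  (alpha%:E <= bottleneck_ratio R d G)%E ->
  (0 < #|S|)%N -> (2 * #|S| <= #|vertex G|)%N ->
  alpha * #|S|%:R <= (edges_out S)%:R / d%:R.
Proof.
move=> h_alpha S_gt0 S_small.
have : (alpha%:E <= (bottleneck_ratio_of R d S)%:E)%E.
  by apply: (le_trans h_alpha); apply: bigmin_le_cond; rewrite S_gt0.
rewrite lee_fin /bottleneck_ratio_of invfM mulrA.
by rewrite ler_pdivlMr // ltr0n.
Qed.

(** Division by zero makes every bottleneck ratio zero when [d = 0]; since the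
    index set is infinite, some graph of the family has at least two vertices,
    and its bottleneck ratio is then a minimum over a nonempty set. *)
Lemma expander_degree_gt0 (R : realType) (d : nat) (alpha : R) (I : set nat)
    (G : nat -> digraph) :
  0 < alpha -> directed_expander_family d alpha I G ->
  (forall n, I n -> #|vertex (G n)| = n) -> (0 < d)%N.
Proof.
move=> alpha_gt0 [I_inf _ _ h_alpha] cardG.
have [n In n_ge2] : exists2 n, I n & (1 < n)%N.
  apply: contrapT => small; apply: I_inf.
  apply: (sub_finite_set _ (finite_II 2)) => n In.
  by rewrite /= ltnNge; apply/negP => n_ge2; apply: small; exists n.
have [v _] : exists v, v \in vertex (G n).
  by apply/card_gt0P; rewrite cardG //; exact: ltnW.
rewrite lt0n; apply/eqP => d0.
have := @bottleneck_ratio_le _ _ _ _ [set v]%SET (h_alpha _ In).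
rewrite cards1 muln1 cardG // d0 invr0 mulr0 mulr1 leNgt alpha_gt0.
by move=> /(_ isT n_ge2).
Qed.

(** * Truncated hitting times *)

Section Avoidance.
Variables (R : realType) (V : finType) (p : V -> V -> R) (y : V).

(** The probability that a chain with transition matrix [p] started from [u] is
    not at [y] at times 1 to [k]; time 0 is not constrained. *)
Fixpoint avoid (k : nat) (u : V) : R :=
  if k is k'.+1 then \sum_(v | v != y) p u v * avoid k' v else 1.

(** The expectation of [min tau_y k] from [x]: the sum over [j < k] of the
    probabilities that [y] is not hit up to time [j]. *)
Definition truncated_hit (k : nat) (x : V) : R :=
  if x == y then 0 else \sum_(j < k) avoid j x.

Lemma avoid_ge0 (k : nat) (u : V) : (forall u v, 0 <= p u v) -> 0 <= avoid k u.
Proof.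
move=> p_ge0; elim: k u => [|k IHk] u //=.
by apply: sumr_ge0 => v _; rewrite mulr_ge0.
Qed.

(** First-step analysis gives equality with [truncated_hit k.+1 x] on the left,
    and truncated hitting times increase with [k]. *)
Lemma truncated_hit_sub (k : nat) (x : V) :
  (forall u v, 0 <= p u v) -> x != y ->
  truncated_hit k x <= 1 + \sum_v p x v * truncated_hit k v.
Proof.
move=> p_ge0 xy; rewrite /truncated_hit (negbTE xy).
apply: le_trans (_ : \sum_(j < k.+1) avoid j x <= _).
  by rewrite big_ord_recr lerDl avoid_ge0.
rewrite big_ord_recl lerD2l /= exchange_big /= [leRHS](bigD1 y) //=.
rewrite eqxx mulr0 add0r.
by apply: ler_sum => v /negbTE ->; rewrite mulr_sumr.
Qed.

End Avoidance.

Arguments avoid {R V} p y k u.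
Arguments truncated_hit {R V} p y k x.

(** * Hitting times of a random walk on a probability space *)

Section Hitting.
Variables (R : realType) (d : nat) (G : digraph) (x y : vertex G).
Variables (disp : measure_display) (Omega : measurableType disp).
Variables (P : probability Omega R) (X : nat -> Omega -> vertex G).
Hypothesis walkX : simple_random_walk d P X x.

Definition unhit (k : nat) : set Omega :=
  [set o | forall i, (i <= k)%N -> X i o != y].

Lemma measurable_pathset (B : nat -> set (vertex G)) (k : nat) :
  measurable [set o | forall i, (i < k)%N -> B i (X i o)].
Proof.
have [mX _ _] := walkX.
have -> : [set o | forall i, (i < k)%N -> B i (X i o)] =
    \bigcap_(i in `I_k) \bigcup_(v in B i) [set o | X i o = v].
  apply/seteqP; split => o /= oB i ik; first by exists (X i o) => //; exact: oB.
  by have [v Bv /= ->] := oB i ik.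
apply: fin_bigcap_measurable => // i _.
by apply: fin_bigcup_measurable => // v _; exact: mX.
Qed.

Definition path_then_avoid (w : nat -> vertex G) (t k : nat) : set Omega :=
  [set o | (forall i, (i <= t)%N -> X i o = w i) /\
           (forall i, (t < i <= t + k)%N -> X i o != y)].

Lemma measurable_path_then_avoid w t k : measurable (path_then_avoid w t k).
Proof.
have -> : path_then_avoid w t k = [set o | forall i, (i < (t + k).+1)%N ->
    (if (i <= t)%N then X i o = w i else X i o != y)].
  apply/seteqP; split => [om [path av] i|om H].
    rewrite ltnS => ik; have [it|ti] := leqP i t; first exact: path.
    by apply: av; rewrite ti.
  split=> [i ti|i /andP[ti ik]].
    by have := H i; rewrite ti; apply; rewrite ltnS (leq_trans ti) ?leq_addr.
  by have := H i; rewrite [(i <= t)%N]leqNgt ti; apply.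
exact: (measurable_pathset (fun i v => if (i <= t)%N then v = w i else v != y)).
Qed.

(** The Markov property is only given for complete paths, so the induction on
    [k], which conditions on the position at time [t.+1], has to keep the whole
    past [w] as a parameter. *)
Lemma prob_path_then_avoid (k t : nat) (w : nat -> vertex G) :
  P (path_then_avoid w t k) =
  (P [set o | forall i, (i <= t)%N -> X i o = w i] *
   (avoid (@walk_step R d G) y k (w t))%:E)%E.
Proof.
have [mX _ markov] := walkX.
elim: k t w => [|k IHk] t w.
  rewrite mule1; congr (P _); apply/seteqP; split => o /=; first by case.
  by move=> path; split=> // i; rewrite addn0 ltnNge => /andP[/negbTE->].
(* The path [w] up to time [t], continued by [v] at time [t.+1] *)
pose ext v i := if i == t.+1 then v else w i.
have -> : path_then_avoid w t k.+1 =
    \bigcup_(v in [set` predC1 y]) path_then_avoid (ext v) t.+1 k.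
  apply/seteqP; split => [om [path av]|om [v /= vy [path av]]].
    exists (X t.+1 om); first by apply: av; rewrite ltnSn addnS ltnS leq_addr.
    split=> [i|i /andP[ti ik]]; last by apply: av; rewrite ltnW //= -addSnnS.
    rewrite /ext leq_eqVlt; case: eqP => [->|_] //=; exact: path.
  split=> [i it|i /andP[ti ik]].
    by rewrite path ?leqW // /ext ltn_eqF.
  move: ti; rewrite leq_eqVlt => /orP[/eqP<-|ti].
    by rewrite path // /ext eqxx.
  by apply: av; rewrite ti addSnnS.
rewrite measure_fin_bigcup //; last 2 first.
- apply/trivIsetP => u v _ _ uv; apply/seteqP; split => // o /= [[pu _] [pv _]].
  move: uv; have := pu _ (leqnn t.+1); rewrite pv // /ext eqxx => ->.
  by rewrite eqxx.
- by move=> v _; exact: measurable_path_then_avoid.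
rewrite -(bigfs _ (r := index_enum (vertex G))) ?index_enum_uniq //; last first.
  by move=> v _; rewrite mem_index_enum.
pose walk := @walk_step R d G.
have walk_ge0 u v : 0 <= walk u v by rewrite divr_ge0.
rewrite /= -sumEFin ge0_sume_distrr; last first.
  by move=> v _; rewrite lee_fin mulr_ge0 // avoid_ge0.
apply: eq_bigr => v _.
rewrite IHk markov /ext eqxx ltn_eqF // [in RHS]EFinM muleA.
congr (P _ * _ * _)%E; apply/seteqP; split => o /= path i it; have := path i it.
  by rewrite ltn_eqF.
by rewrite ltn_eqF.
Qed.

Lemma prob_unhit_le (k : nat) :
  (P (unhit k) <= (if x == y then 0 else avoid (@walk_step R d G) y k x)%:E)%E.
Proof.
have [mX X0 _] := walkX.
have mU : measurable (unhit k).
  exact: (measurable_pathset (fun _ v => v != y) k.+1).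
(* The walk starts at [x] almost surely. *)
have start : P (unhit k) = P (unhit k `&` [set o | X 0%N o = x]).
  have X0c : P (~` [set o | X 0%N o = x]) = 0%E.
    by rewrite probability_setC ?X0 ?subee // ; exact: mX.
  rewrite [LHS](measureDI P mU (mX 0%N x)).
  rewrite [X in (X + _)%E](_ : _ = 0%E) ?add0e //.
  apply: (subset_measure0 _ _ _ X0c); last by move=> o [].
    by apply: measurableD; [exact: mU|exact: mX].
  by apply: measurableC; exact: mX.
rewrite start; case: eqP => [xy|xy].
  have -> : unhit k `&` [set o | X 0%N o = x] = set0.
    by apply/seteqP; split => // o [/(_ 0%N isT) + /= ox]; rewrite ox xy eqxx.
  by rewrite measure0.
have -> : unhit k `&` [set o | X 0%N o = x] = path_then_avoid (fun=> x) 0 k.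
  apply/seteqP; split => o /=.
    move=> [av ox]; split=> [i|i /andP[_]]; first by rewrite leqn0 => /eqP ->.
    exact: av.
  move=> [path av]; have ox := path 0%N isT; split=> // -[_|i ik].
    by rewrite ox; exact/eqP.
  exact: av.
rewrite prob_path_then_avoid.
have -> : [set o | forall i, (i <= 0)%N -> X i o = x] = [set o | X 0%N o = x].
  by apply/seteqP; split => o /=; [exact|move=> ox i; rewrite leqn0 => /eqP ->].
by rewrite X0 mul1e.
Qed.

(** The event [unhit k] holds exactly for [k < tau_y].  This also spares a
    separate proof that the hitting time is measurable. *)
Lemma hitting_time_series (o : Omega) :
  hitting_time R X y o = (\sum_(0 <= k <oo) (\1_(unhit k) o)%:E)%E.
Proof.
have [[m0 Xm0]|nohit] := pselect (exists m, X m o == y); last first.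
  have -> : hitting_time R X y o = +oo%E.
    rewrite /hitting_time; have -> : [set t | X t o = y] = set0.
      by apply/seteqP; split => // t /= /eqP Xt; apply: nohit; exists t.
    by rewrite image_set0 ereal_inf0.
  apply/esym/eqyP => A A_gt0; have [n An] : exists n, A <= n%:R.
    by exists (Num.truncn A).+1; rewrite ltW // truncnS_gt.
  apply: (@le_trans _ _ (\sum_(0 <= k < n) (\1_(unhit k) o)%:E)%E); last first.
    by apply: nneseries_lim_ge => k _ _; rewrite lee_fin.
  rewrite sumEFin lee_fin; apply: (le_trans An).
  rewrite -[leLHS]mulr1 mulr_natl -[n in leLHS]subn0 -sumr_const_nat.
  apply: ler_sum => k _; rewrite indicE mem_set // => i _.
  by apply/negP => Xi; apply: nohit; exists i.
case: (ex_minnP (ex_intro (fun m => X m o == y) m0 Xm0)) => m Xm m_min {m0 Xm0}.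
have -> : hitting_time R X y o = (m%:R)%:E.
  apply: le_anti; apply/andP; split.
    by apply: ereal_inf_lbound; exists m => //; exact/eqP.
  apply: le_ereal_inf_tmp => _ [t /= /eqP Xt <-]; rewrite lee_fin ler_nat.
  exact: m_min.
rewrite (nneseries_split 0 m); last by move=> k _; rewrite lee_fin.
rewrite add0n [X in (_ + X)%E]eseries0; last first.
  move=> k mk _; rewrite indicE memNset // => /(_ m mk).
  by rewrite Xm.
rewrite adde0 sumEFin; congr EFin.
rewrite -[LHS]mulr1 mulr_natl -[m in LHS]subn0 -sumr_const_nat.
apply: eq_big_nat => k /andP[_ km]; rewrite indicE mem_set // => i ik.
by apply/negP => /m_min; rewrite leqNgt (leq_ltn_trans ik km).
Qed.

Lemma integral_hitting_time_le (B : R) :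
  (forall k, truncated_hit (@walk_step R d G) y k x <= B) ->
  (\int[P]_o hitting_time R X y o <= B%:E)%E.
Proof.
move=> hB.
have mU k : measurable (unhit k).
  exact: (measurable_pathset (fun _ v => v != y) k.+1).
under eq_integral do rewrite hitting_time_series.
rewrite integral_nneseries //=; last first.
  by move=> k; apply/measurable_EFinP; exact: measurable_indic.
under eq_eseriesr => k _ do rewrite integral_indic // setIT.
apply: lime_le; first exact: is_cvg_nneseries.
apply: nearW => n.
have le_trunc : (\sum_(0 <= k < n) P (unhit k) <=
    (truncated_hit (@walk_step R d G) y n x)%:E)%E.
  apply: (le_trans (lee_sum _ (fun k _ => prob_unhit_le k))).
  rewrite sumEFin lee_fin /truncated_hit; case: eqP => _; first by rewrite big1.
  by rewrite big_mkord.
by apply: (le_trans le_trunc); rewrite lee_fin.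
Qed.

End Hitting.

Theorem theorem5 (R : realType) (alpha : R) (halpha : 0 < alpha) :
  exists2 C : R, 0 < C &
    forall (d : nat) (I : set nat) (G : nat -> digraph),
      directed_expander_family d alpha I G ->
      (forall n, I n -> #|vertex (G n)| = n) ->
      forall n, I n -> forall x y : vertex (G n),
      forall (disp : measure_display) (Omega : measurableType disp)
        (P : probability Omega R) (X : nat -> Omega -> vertex (G n)),
        simple_random_walk d P X x ->
        (\int[P]_o hitting_time R X y o < (C * n%:R)%:E)%E.
Proof.
(* The family also expands with any smaller constant, and the level set bounds
   use that [2 <= 2 / a]. *)
pose a := Num.min alpha 1.
have a_gt0 : 0 < a by rewrite lt_min halpha ltr01.
have a_le1 : a <= 1 by rewrite ge_min lexx orbT.
have a_alpha : a <= alpha by rewrite ge_min lexx.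
pose C := 8 / a ^+ 2 + 2 / a + 1.
have C_gt0 : 0 < C by rewrite !addr_gt0 ?divr_gt0 ?exprn_gt0.
exists (C + 1) => [|d I G famG cardG n In x y disp Omega P X walkX].
  by rewrite addr_gt0.
have d_gt0 := expander_degree_gt0 _ _ _ _ _ halpha famG cardG.
have d_neq0 : d%:R != 0 :> R by rewrite pnatr_eq0 -lt0n.
have [_ _ degG expG] := famG.
have n_gt0 : 0 < n%:R :> R.
  by rewrite ltr0n -(cardG n In); apply/card_gt0P; exists x.
pose p := @walk_step R d (G n).
have p_ge0 u v : 0 <= p u v by rewrite divr_ge0.
have p_row u : \sum_v p u v = 1.
  by rewrite sum_walk_step_tgt (degG n In u).2 divff.
have p_col v : \sum_u p u v = 1.
  by rewrite sum_walk_step_src (degG n In v).1 divff.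
have expansion (A : {set vertex (G n)}) :
    (0 < #|A|)%N -> (2 * #|A| <= #|vertex (G n)|)%N ->
    a * #|A|%:R <= flow p A (~: A)%SET.
  move=> A_gt0 A_small; rewrite flow_walk_step.
  apply: le_trans (bottleneck_ratio_le _ _ _ _ _ (expG n In) A_gt0 A_small).
  by rewrite ler_wpM2r.
apply: (@le_lt_trans _ _ (C * n%:R)%:E); last first.
  by rewrite lte_fin ltr_pM2r // ltrDl.
apply: (integral_hitting_time_le _ _ _ _ _ _ _ _ _ walkX) => k.
apply: (@le_trans _ _ (C * #|vertex (G n)|%:R)); last by rewrite cardG.
apply: ltW.
apply: (subsolution_lt _ _ p a p_ge0 p_row p_col a_gt0 a_le1 expansion _ y).
  by rewrite /truncated_hit eqxx.
by move=> z zy; exact: truncated_hit_sub.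
Qed.
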